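(* If a rectifiable space $G$ is pointwise canonically weakly pseudocompact, then $G$ is a Moscow space.
   Context: All spaces are assumed to be $T_1$ and regular. A topological space $G$ is a rectifiable space if there are a surjective homeomorphism $\varphi: G\times G\to G\times G$ and an element $e\in G$ such that $\pi_1\circ\varphi=\pi_1$ and $\varphi(x,x)=(x,e)$ for every $x\in G$, where $\pi_1:G\times G\to G$ is the projection to the first coordinate. A space $X$ is Moscow if for each open subset $U$ of $X$ the set $\overline{U}$ is the union of a family of $G_\delta$-sets in $X$; that is, for every $x\in\overline{U}$ there is a $G_\delta$-set $P$ in $X$ with $x\in P\subset\overline{U}$. A set $U$ is regular open if it equals the interior of its closure. A point $x\in X$ is a cwp-point of $X$ if for every regular open subset $U$ of $X$ with $x\in\overline{U}$ there is a sequence $\{A_n:n\in\mathbb{N}\}$ of subsets of $U$ such that $x\in\overline{A_n}$ for every $n\in\mathbb{N}$, and such that every indexed family $\eta=\{O_n:n\in\mathbb{N}\}$ of open subsets of $X$ satisfying $O_n\cap A_n\neq\emptyset$ for every $n\in\mathbb{N}$ has an accumulation point in $X$ (a point each neighborhood of which meets $O_n$ for infinitely many $n$). A space $X$ is pointwise canonically weakly pseudocompact if each point of $X$ is a cwp-point. *)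

(* Defs.v *)
From mathcomp Require Import all_boot all_classical topology borel_hierarchy.

Set Implicit Arguments.
Unset Strict Implicit.
Unset Printing Implicit Defensive.

Local Open Scope classical_set_scope.

Definition homeomorphism (X Y : topologicalType) (f : X -> Y) : Prop :=
  continuous f /\
  exists g : Y -> X, [/\ continuous g, cancel f g & cancel g f].

Definition rectifiable_space (G : topologicalType) : Prop :=
  exists (phi : G * G -> G * G) (e : G),
    [/\ homeomorphism phi,
        forall p : G * G, (phi p).1 = p.1
      & forall x : G, phi (x, x) = (x, e)].

Definition moscow_space (X : topologicalType) : Prop :=
  forall U : set X, open U -> forall x : X, closure U x ->
    exists P : set X, [/\ Gdelta P, P x & P `<=` closure U].

(* The family O is indexed: the indices n are counted, not the distinct
   sets O n, so a constant family of nonempty sets has accumulation points. *)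
Definition family_accumulation_point (X : topologicalType)
    (O : nat -> set X) (y : X) : Prop :=
  forall V : set X, nbhs y V -> infinite_set [set n | V `&` O n !=set0].

Definition cwp_point (X : topologicalType) (x : X) : Prop :=
  forall U : set X, regopen U -> closure U x ->
    exists A : nat -> set X,
      [/\ forall n, A n `<=` U,
          forall n, closure (A n) x
        & forall O : nat -> set X,
            (forall n, open (O n)) ->
            (forall n, O n `&` A n !=set0) ->
            exists y : X, family_accumulation_point O y].

Definition pointwise_canonically_weakly_pseudocompact (X : topologicalType)
    : Prop :=
  forall x : X, cwp_point x.

(* Main.v *)
Require Import Defs.
From mathcomp Require Import all_boot all_classical topology borel_hierarchy.

(** A rectifiable space carries a continuous ternary operation m with
m(a, y, y) = a and m(y, y, z) = z, the analogue of a y^-1 z in a topological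
group (rectifiable_maltsev).

Let x lie in the closure of an open set.  Replacing this set by the interior
of its closure, one may assume that it is a regular open set U, and take the
sets A_n given by the cwp property of x.  Since m(a, x, x) = a is in U for a
in A_n, continuity and regularity yield open sets O_n meeting A_n and open
neighborhoods W_n of x such that O_n is contained in W_n, the closure of
W_(n+1) is contained in W_n, and m maps O_n * W_(n+1) * W_(n+1) into U
(maltsev_refine).  Let P be the intersection of the W_n, a G_delta set
containing x.

The O_n have an accumulation point y, which lies in P because the W_n shrink
with closures.  For z in P the continuous map a |-> m(a, y, z) sends y to z and
every O_n into U; as y is in the closure of the union of the O_n, its image z
is in the closure of U (maltsev_accumulation).  Hence P is contained in the
closure of U. *)

Set Implicit Arguments.
Unset Strict Implicit.
Unset Printing Implicit Defensive.

Local Open Scope classical_set_scope.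

Definition maltsev_operation (G : topologicalType) (m : G -> G -> G -> G)
    : Prop :=
  [/\ continuous (fun t : G * (G * G) => m t.1 t.2.1 t.2.2),
      forall a y, m a y y = a
    & forall y z, m y y z = z].

(** In a topological group phi(y, z) = (y, y^-1 z), so q is left division and p
is multiplication; in general p and q still satisfy p(y, q(y, z)) = z,
q(y, y) = e and p(a, e) = a. *)
Lemma rectifiable_maltsev (G : topologicalType) :
  rectifiable_space G -> exists m : G -> G -> G -> G, maltsev_operation m.
Proof.
case=> phi [e [[phi_cont [psi [psi_cont phiK psiK]]] phi1 phi_diag]].
pose p a b := (psi (a, b)).2; pose q y z := (phi (y, z)).2.
exists (fun a y z => p a (q y z)); split.
- move=> t; rewrite /p /q.
  apply: (@continuous_comp _ _ _ (fun t : G * (G * G) =>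
    psi (t.1, (phi (t.2.1, t.2.2)).2)) snd); last exact: cvg_snd.
  apply: (@continuous_comp _ _ _ (fun t : G * (G * G) =>
    (t.1, (phi (t.2.1, t.2.2)).2)) psi); last exact: psi_cont.
  apply: cvg_pair => /=; first exact: cvg_fst.
  apply: (@continuous_comp _ _ _ (fun t : G * (G * G) =>
    phi (t.2.1, t.2.2)) snd); last exact: cvg_snd.
  apply: (@continuous_comp _ _ _ (fun t : G * (G * G) =>
    (t.2.1, t.2.2)) phi); last exact: phi_cont.
  rewrite (_ : (fun _ => _) = snd) ?funeqE => [|[? []//]]; exact: cvg_snd.
- by move=> a y; rewrite /q phi_diag /p -(phi_diag a) phiK.
- move=> y z; rewrite /p /q.
  by rewrite -[X in (X, _)](phi1 (y, z)) -surjective_pairing phiK.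
Qed.

Lemma maltsev_box (G : topologicalType) (m : G -> G -> G -> G)
    (U : set G) (a x : G) :
  maltsev_operation m -> open U -> U a ->
  exists O W : set G, [/\ open_nbhs a O, nbhs x W
    & forall a' y z, O a' -> W y -> W z -> U (m a' y z)].
Proof.
case=> m_cont m_id _ oU Ua.
have : nbhs (m a x x) U by rewrite m_id; exact: open_nbhs_nbhs.
move=> /(m_cont (a, (x, x)) U) mU.
have [[O V] /= [aO xV] OVU] := mU.
have [[V1 V2] /= [xV1 xV2] V12V] := xV.
move: aO; rewrite [nbhs a]nbhsE => -[O' aO' O'O].
exists O', (V1 `&` V2); split=> // [|a' y z O'a' [V1y _] [_ V2z]].
  exact: filterI.
by apply: (OVU (a', (y, z))); split; [exact: O'O | exact: V12V].
Qed.

(** One step of the recursion, with A = A_n and W = W_n: as x is in the closure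
of A, some a in A lies in W, and continuity of m at (a, x, x), where its value
a is in U, gives O and W', which regularity allows to shrink into W. *)
Lemma maltsev_refine (G : topologicalType) (m : G -> G -> G -> G)
    (A U W : set G) (x : G) :
  maltsev_operation m ->
  regular_space G -> open U -> A `<=` U -> closure A x -> open_nbhs x W ->
  exists O W' : set G,
    [/\ open O /\ O `<=` W, O `&` A !=set0,
        open_nbhs x W' /\ closure W' `<=` W
      & forall a y z, O a -> W' y -> W' z -> U (m a y z)].
Proof.
move=> m_maltsev G_regular oU AU xA oxW.
have [a [Aa Wa]] : A `&` W !=set0 by apply: xA; exact: open_nbhs_nbhs.
have [O [V [[oO Oa] xV OVU]]] := maltsev_box x m_maltsev oU (AU _ Aa).
have [N xN NW] := G_regular x W (open_nbhs_nbhs oxW).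
have : nbhs x (N `&` V) by exact: filterI.
rewrite [nbhs x]nbhsE => -[W' oxW' W'NV].
exists (O `&` W), W'; split=> [|||b y z [Ob _] /W'NV[_ Vy] /W'NV[_ Vz]].
- by split; [apply: openI => //; case: oxW | exact: subIsetr].
- by exists a.
- split=> //; apply: subset_trans NW; apply: closureS.
  by move=> t /W'NV[].
- exact: OVU.
Qed.

(** An accumulation point y of the O_n lies in every W_n, so for z in the
intersection of the W_n the translation a |-> m(a, y, z) takes each O_n into U,
while it takes y to z. *)
Lemma maltsev_accumulation (G : topologicalType) (m : G -> G -> G -> G)
    (U : set G) (O W : nat -> set G) (y : G) :
  maltsev_operation m ->
  (forall n, O n `<=` W n) -> (forall n, closure (W n.+1) `<=` W n) ->
  (forall n a y z, O n a -> W n.+1 y -> W n.+1 z -> U (m a y z)) ->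
  family_accumulation_point O y -> \bigcap_n W n `<=` closure U.
Proof.
case=> m_cont _ m_id OW WW OWU y_acc z Pz.
have W_decr i j : (i <= j)%N -> W j `<=` W i.
  elim: j => [|j IH]; first by rewrite leqn0 => /eqP ->.
  rewrite leq_eqVlt ltnS => /predU1P[-> //|/IH]; apply: subset_trans.
  by apply: subset_trans (WW j); exact: subset_closure.
have Py n : W n y.
  apply: WW => V yV.
  (* V meets O k for infinitely many k, hence for one with O k inside W n.+1. *)
  have [k [t [Vt Okt]] nk] : exists2 k, V `&` O k !=set0 & (n < k)%N.
    have [k [VOk /= nk]] :=
      infinite_setN0 (infinite_setD (y_acc V yV) (finite_II n.+1)).
    by exists k => //; rewrite ltnNge -ltnS; exact/negP.
  by exists t; split=> //; apply: (W_decr _ k) => //; exact: OW.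
move=> N zN.
have yN : nbhs y [set a | N (m a y z)].
  have m_cont_y : (fun a => m a y z) @ y --> m y y z.
    apply: (@continuous_comp _ _ _ (fun a => (a, (y, z)))
      (fun t : G * (G * G) => m t.1 t.2.1 t.2.2)); last exact: m_cont.
    by apply: (cvg_pair (G := nbhs y) (H := nbhs (y, z)));
      [exact: cvg_id | exact: cvg_cst].
  by move: (m_cont_y N); rewrite m_id; apply.
have [k [a [Na Oka]]] := infinite_setN0 (y_acc _ yN).
by exists (m a y z); split=> //; apply: (OWU k) => //; exact: Pz.
Qed.

(** For an arbitrary operation m, this also covers retracts of topological
groups, such as a closed interval of the line, which need not be homogeneous
and hence need not be rectifiable. *)
Lemma maltsev_moscow (G : topologicalType) (m : G -> G -> G -> G) :
  maltsev_operation m -> regular_space G ->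
  pointwise_canonically_weakly_pseudocompact G -> moscow_space G.
Proof.
move=> m_maltsev G_regular G_cwp U0 oU0 x xU0; pose U : set G := (closure U0)°.
have oU : open U by exact: open_interior.
have UU0 : closure U `<=` closure U0.
  rewrite [X in _ `<=` X](closure_id _).1; last exact: closed_closure.
  by apply: closureS; exact: interior_subset.
have xU : closure U x.
  by apply: closureS xU0; rewrite -open_subsetE//; exact: subset_closure.
have [A [AU xA A_acc]] :=
  G_cwp x U (interior_closed_regopen (@closed_closure _ U0)) xU.
(* The stage n is paired with the set W, as each step uses its own A n. *)
have /choice[f fP] : forall nW : nat * set G, exists OW' : set G * set G,
    open_nbhs x nW.2 ->
    [/\ open OW'.1 /\ OW'.1 `<=` nW.2, OW'.1 `&` A nW.1 !=set0,
        open_nbhs x OW'.2 /\ closure OW'.2 `<=` nW.2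
      & forall a y z, OW'.1 a -> OW'.2 y -> OW'.2 z -> U (m a y z)].
  move=> [n W]; have [oxW|] := pselect (open_nbhs x W); last by exists (W, W).
  have [O [W' ?]] := maltsev_refine m_maltsev G_regular oU (AU n) (xA n) oxW.
  by exists (O, W').
pose W := nat_rect (fun=> set G) setT (fun n Wn => (f (n, Wn)).2).
pose O n := (f (n, W n)).1.
have oxW n : open_nbhs x (W n).
  elim: n => [|n IH]; first by split=> //; exact: openT.
  by have [_ _ []] := fP (n, W n) IH.
have OWP n := fP (n, W n) (oxW n).
have [y y_acc] : exists y, family_accumulation_point O y.
  by apply: A_acc => n; have [[]] := OWP n.
exists (\bigcap_n W n); split.
- by exists W => // n; case: (oxW n).
- by move=> n _; case: (oxW n).
- apply: subset_trans UU0.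
  apply: (maltsev_accumulation m_maltsev _ _ _ y_acc) => [n|n|n].
  + by have [[]] := OWP n.
  + by have [_ _ []] := OWP n.
  + by have [] := OWP n.
Qed.

Theorem theorem5p1 (G : topologicalType)
  (G_T1 : accessible_space G) (G_regular : regular_space G)
  (G_rectifiable : rectifiable_space G)
  (G_cwp : pointwise_canonically_weakly_pseudocompact G) :
  moscow_space G.
Proof.
have [m m_maltsev] := rectifiable_maltsev G_rectifiable.
exact: maltsev_moscow m_maltsev G_regular G_cwp.
Qed.
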